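(* Let $p,q\geq 0$, $t\in Y_p$ and $w\in Y_q$. In $\mathbf{Q}[Y_\infty]$ one has $$t*w=\sum_{u\in Y_{p+q},\ t/w\leq u\leq t\backslash w}u ,$$ where $\leq$ is the weak order on $Y_{p+q}$.
   Context: For $n\geq0$, $Y_n$ is the set of planar binary rooted trees with $n$ internal vertices ($Y_0=\{|\}$, the tree with one leaf and no vertex). The grafting $u\vee v\in Y_{p+q+1}$ of $u\in Y_p$, $v\in Y_q$ is obtained by joining the roots of $u$ and $v$ to a new vertex (with $u$ on the left) and adding a new root; every $t\in Y_n$, $n\geq1$, is uniquely $t=t^l\vee t^r$. The weak order $\leq$ on $Y_n$ is the partial order generated (reflexively and transitively) by: (a) if $u\leq u'$ in $Y_p$ and $v\leq v'$ in $Y_q$ then $u\vee v\leq u'\vee v'$; (b) $(u\vee v)\vee w\leq u\vee(v\vee w)$ for all trees $u,v,w$. Over and under, $Y_p\times Y_q\to Y_{p+q}$: $u/v$ is obtained by identifying the root of $u$ with the leftmost leaf of $v$, and $u\backslash v$ by identifying the rightmost leaf of $u$ with the root of $v$; recursively $t/|=t=|\backslash t$, $t\backslash|=t=|/t$, $u/v=(u/v^l)\vee v^r$, $u\backslash v=u^l\vee(u^r\backslash v)$. $\mathbf{Q}[Y_\infty]=\bigoplus_{n\ge0}\mathbf{Q}[Y_n]$ has the product defined recursively by $t*|=|*t=t$ and, for $t=t^l\vee t^r$, $w=w^l\vee w^r$, $t*w=(t*w^l)\vee w^r+t^l\vee(t^r*w)$, with $\vee$ extended bilinearly. *)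

(* Defs.v *)
From HB Require Import structures.
From mathcomp Require Import all_boot all_order all_algebra.
From mathcomp Require Import boolp finmap.
From mathcomp.multinomials Require Import monalg.

Set Implicit Arguments.
Unset Strict Implicit.
Unset Printing Implicit Defensive.

Import GRing.Theory.
Local Open Scope ring_scope.

Inductive bintree := Leaf | Graft of bintree & bintree.

Declare Scope bintree_scope.
Delimit Scope bintree_scope with tree.
Bind Scope bintree_scope with bintree.
Local Open Scope bintree_scope.

Notation "u \vee v" := (Graft u v)
  (at level 45, no associativity) : bintree_scope.

Fixpoint tree_code (t : bintree) : GenTree.tree unit :=
  match t with
  | Leaf => GenTree.Node 0 [::]
  | tl \vee tr => GenTree.Node 1 [:: tree_code tl; tree_code tr]
  end.

Fixpoint tree_decode (c : GenTree.tree unit) : bintree :=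
  match c with
  | GenTree.Node _ [:: cl; cr] => tree_decode cl \vee tree_decode cr
  | _ => Leaf
  end.

Lemma tree_codeK : cancel tree_code tree_decode.
Proof. by elim=> //= l -> r ->. Qed.

HB.instance Definition _ := Countable.copy bintree (can_type tree_codeK).

Fixpoint vertices (t : bintree) : nat :=
  match t with
  | Leaf => 0
  | tl \vee tr => (vertices tl + vertices tr).+1
  end.

Record Y (n : nat) : predArgType :=
  MkY { tree_of :> bintree; _ : vertices tree_of == n }.

HB.instance Definition _ n := [isSub for @tree_of n].
HB.instance Definition _ n := [Countable of Y n by <:].

Lemma verticesY n (t : Y n) : vertices t = n.
Proof. exact/eqP/(valP t). Qed.

(* An enumeration, possibly with repetitions, of the trees of height at
   most [h]; those with [n] vertices all occur for [h = n]. *)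
Fixpoint trees_upto (h : nat) : seq bintree :=
  match h with
  | 0 => [:: Leaf]
  | h'.+1 => Leaf :: [seq u \vee v | u <- trees_upto h', v <- trees_upto h']
  end.

Lemma mem_trees_upto t h : (vertices t <= h)%N -> t \in trees_upto h.
Proof.
elim: t h => [|u IHu v IHv] [|h] //=; rewrite ltnS inE /= => le_h.
apply/allpairsP; exists (u, v); split => //=.
- exact/IHu/(leq_trans _ le_h)/leq_addr.
- exact/IHv/(leq_trans _ le_h)/leq_addl.
Qed.

Definition enumY n : seq (Y n) := undup (pmap insub (trees_upto n)).

Lemma mem_enumY n (t : Y n) : t \in enumY n.
Proof.
by rewrite mem_undup mem_pmap_sub mem_trees_upto // verticesY.
Qed.

HB.instance Definition _ n :=
  isFinite.Build (Y n) (Finite.uniq_enumP (undup_uniq _) (@mem_enumY n)).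

(* The weak orders of all the [Y n] together: by [weak_le_vertices], only
   trees with the same number of vertices are related. *)
Inductive weak_le : bintree -> bintree -> Prop :=
| weak_le_refl u : weak_le u u
| weak_le_trans u v w : weak_le u v -> weak_le v w -> weak_le u w
| weak_le_graft u u' v v' :
    weak_le u u' -> weak_le v v' -> weak_le (u \vee v) (u' \vee v')
| weak_le_rot u v w : weak_le ((u \vee v) \vee w) (u \vee (v \vee w)).

Lemma weak_le_vertices u v : weak_le u v -> vertices u = vertices v.
Proof.
elim=> {u v} //= [u v w _ -> _ -> //|u u' v v' _ -> _ -> //|u v w].
by rewrite addSn addnS addnA.
Qed.

Fixpoint over (u v : bintree) : bintree :=
  match v with
  | Leaf => u
  | vl \vee vr => over u vl \vee vr
  end.

Fixpoint under (u v : bintree) : bintree :=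
  match u with
  | Leaf => v
  | ul \vee ur => ul \vee under ur v
  end.

Lemma over_leafl v : over Leaf v = v.
Proof. by elim: v => //= l -> r. Qed.

Lemma under_leafr u : under u Leaf = u.
Proof. by elim: u => //= l _ r ->. Qed.

Lemma vertices_over u v : vertices (over u v) = (vertices u + vertices v)%N.
Proof. by elim: v => [|l IHl r _] /=; rewrite ?addn0 // IHl addnS addnA. Qed.

Lemma vertices_under u v : vertices (under u v) = (vertices u + vertices v)%N.
Proof. by elim: u => [|l _ r IHr] //=; rewrite IHr addSn addnA. Qed.

Lemma overY_subproof p q (t : Y p) (w : Y q) :
  vertices (over t w) == (p + q)%N.
Proof. by rewrite vertices_over !verticesY. Qed.

Definition overY p q (t : Y p) (w : Y q) : Y (p + q) :=
  MkY (overY_subproof t w).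

Lemma underY_subproof p q (t : Y p) (w : Y q) :
  vertices (under t w) == (p + q)%N.
Proof. by rewrite vertices_under !verticesY. Qed.

Definition underY p q (t : Y p) (w : Y q) : Y (p + q) :=
  MkY (underY_subproof t w).

Definition weak_leY n (u v : Y n) : Prop := weak_le u v.

(* Trees of all sizes form a basis of the direct sum of the Q[Y_n]. *)
Notation QY := {malg rat[bintree]}.

Definition bilin_ext (f : bintree -> bintree -> QY) (x y : QY) : QY :=
  \sum_(u <- msupp x) \sum_(v <- msupp y) (x@_u * y@_v) *: f u v.

Definition graftQ : QY -> QY -> QY := bilin_ext (fun u v => << u \vee v >>).

(* The nested fixpoint makes the two-variable recursion structural. *)
Fixpoint tree_prod (t : bintree) : bintree -> QY :=
  match t with
  | Leaf => fun w => << w >>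
  | tl \vee tr =>
      fix prod_t (w : bintree) : QY :=
        match w with
        | Leaf => << tl \vee tr >>
        | wl \vee wr =>
            graftQ (prod_t wl) << wr >> +
            graftQ << tl >> (tree_prod tr (wl \vee wr))
        end
  end.

Definition prodQ : QY -> QY -> QY := bilin_ext tree_prod.

Lemma bilin_extE f (x y : QY) (dx dy : {fset bintree}%fset) :
  (msupp x `<=` dx)%fset -> (msupp y `<=` dy)%fset ->
  bilin_ext f x y = \sum_(u <- dx) \sum_(v <- dy) (x@_u * y@_v) *: f u v.
Proof.
move=> sx sy; rewrite /bilin_ext (big_fset_incl _ sx) /=; last first.
  move=> u _ /mcoeff_outdom ->; rewrite big1 // => v _.
  by rewrite mul0r scale0r.
apply: eq_bigr => u _; rewrite (big_fset_incl _ sy) //= => v _.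
by move=> /mcoeff_outdom ->; rewrite mulr0 scale0r.
Qed.

Lemma bilin_extU f u v : bilin_ext f << u >> << v >> = f u v.
Proof.
by rewrite /bilin_ext !msuppU oner_eq0 !big_seq_fset1 !mcoeffUU mul1r scale1r.
Qed.

Lemma bilin_ext_linearl f a x x' y :
  bilin_ext f (a *: x + x') y = a *: bilin_ext f x y + bilin_ext f x' y.
Proof.
pose d := (msupp (a *: x + x') `|` (msupp x `|` msupp x'))%fset.
rewrite !(@bilin_extE f _ y d (msupp y)) ?fsubsetUl //; first last.
- by rewrite /d fsubsetU // fsubsetUl orbT.
- by rewrite /d fsubsetU // fsubsetUr orbT.
rewrite scaler_sumr -big_split /=; apply: eq_bigr => u _.
rewrite scaler_sumr -big_split /=; apply: eq_bigr => v _.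
by rewrite mcoeffD mcoeffZ scalerA -scalerDl mulrDl mulrA.
Qed.

Lemma bilin_ext_linearr f a x y y' :
  bilin_ext f x (a *: y + y') = a *: bilin_ext f x y + bilin_ext f x y'.
Proof.
pose d := (msupp (a *: y + y') `|` (msupp y `|` msupp y'))%fset.
rewrite !(@bilin_extE f x _ (msupp x) d) ?fsubsetUl //; first last.
- by rewrite /d fsubsetU // fsubsetUl orbT.
- by rewrite /d fsubsetU // fsubsetUr orbT.
rewrite scaler_sumr -big_split /=; apply: eq_bigr => u _.
rewrite scaler_sumr -big_split /=; apply: eq_bigr => v _.
by rewrite mcoeffD mcoeffZ scalerA -scalerDl mulrDr mulrCA.
Qed.

Lemma prodQ_leafl t : prodQ << Leaf >> << t >> = << t >>.
Proof. exact: bilin_extU. Qed.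

Lemma prodQ_leafr t : prodQ << t >> << Leaf >> = << t >>.
Proof. by rewrite /prodQ bilin_extU; case: t. Qed.

Lemma prodQ_graft tl tr wl wr :
  prodQ << tl \vee tr >> << wl \vee wr >> =
  graftQ (prodQ << tl \vee tr >> << wl >>) << wr >> +
  graftQ << tl >> (prodQ << tr >> << wl \vee wr >>).
Proof. by rewrite /prodQ !bilin_extU. Qed.

(* Main.v *)
Require Import Defs.
From mathcomp Require Import all_boot all_order all_algebra.
From mathcomp Require Import boolp finmap.
From mathcomp.multinomials Require Import monalg.
From mathcomp Require Import zify.

(* Cutting a tree [u] along the path from its [p]-th leaf (counted from 0 on
   the left) to the root yields a left tree with [p] vertices and a right tree.
   The recursion defining the product says exactly that the trees occurring in
   [t * w] are those which this cut splits into [t] and [w], each with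
   coefficient 1.  Both halves of the cut are monotone for the weak order, the
   cut splits [t / w] and [t \ w] into [t] and [w], and conversely every [u]
   lies between the over and the under product of its two halves; hence, by
   antisymmetry, the trees cut into [t] and [w] form the interval. *)

Local Open Scope ring_scope.
Import GRing.Theory.
(* Restores [Defs.over], shadowed by the [over] of ssreflect. *)
Import Defs.

Lemma graft_eq (a b c d : bintree) :
  ((a \vee b)%tree == (c \vee d)%tree) = (a == c) && (b == d).
Proof. by apply/eqP/andP => [[-> ->]|[/eqP-> /eqP->]]. Qed.

Lemma weak_le_graftl u u' v :
  weak_le u u' -> weak_le (u \vee v)%tree (u' \vee v)%tree.
Proof. by move=> le_u; apply: weak_le_graft le_u (weak_le_refl v). Qed.

Lemma weak_le_graftr u v v' :
  weak_le v v' -> weak_le (u \vee v)%tree (u \vee v')%tree.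
Proof. exact: weak_le_graft (weak_le_refl u). Qed.

(** The sum over all vertices of the size of the right subtree. The rotation of [u], [v], [w] raises
    it by [(vertices w).+1], whence antisymmetry. *)
Fixpoint right_weight (t : bintree) : nat :=
  match t with
  | Leaf => 0
  | Graft l r => right_weight l + right_weight r + vertices r
  end.

Lemma weak_le_eqVlt u v :
  weak_le u v -> u = v \/ (right_weight u < right_weight v)%N.
Proof.
elim=> {u v} [u|u v w _ IHuv _ IHvw|u u' v v' _ IHu le_v IHv|u v w].
- by left.
- by case: IHuv IHvw => [->|?] [<-|?]; [left|right|right|right; lia].
- have /= := weak_le_vertices le_v.
  by case: IHu IHv => [->|?] [<-|?] /= ?; [left|right; lia..].
- by right => /=; lia.
Qed.

Lemma weak_le_anti u v : weak_le u v -> weak_le v u -> u = v.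
Proof. by move=> /weak_le_eqVlt[//|?] /weak_le_eqVlt[//|?]; lia. Qed.

(** As [l] has [(vertices l).+1] leaves, a leaf beyond them is renumbered by that shift in [r]. Any
    [p] past the last leaf acts as the last leaf. *)
Fixpoint cutl (p : nat) (t : bintree) : bintree :=
  match t with
  | Leaf => Leaf
  | Graft l r =>
      if (p <= vertices l)%N then cutl p l
      else Graft l (cutl (p - (vertices l).+1) r)
  end.

Fixpoint cutr (p : nat) (t : bintree) : bintree :=
  match t with
  | Leaf => Leaf
  | Graft l r =>
      if (p <= vertices l)%N then Graft (cutr p l) r
      else cutr (p - (vertices l).+1) r
  end.

Lemma vertices_cut p u :
  (vertices (cutl p u) + vertices (cutr p u) = vertices u)%N.
Proof.
elim: u p => //= l IHl r IHr p.
case: ifP => _ /=; first by rewrite addnS addnA IHl.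
by rewrite addSn -addnA IHr.
Qed.

Lemma cutl0 u : cutl 0 u = Leaf.
Proof. by elim: u. Qed.

Lemma cutr0 u : cutr 0 u = u.
Proof. by elim: u => //= l -> r. Qed.

Lemma cutl_vertices u : cutl (vertices u) u = u.
Proof.
elim: u => //= l _ r IHr.
by rewrite ifF; [rewrite subSS addKn IHr | lia].
Qed.

Lemma cutr_vertices u : cutr (vertices u) u = Leaf.
Proof.
elim: u => //= l _ r IHr.
by rewrite ifF; [rewrite subSS addKn IHr | lia].
Qed.

Lemma cutl_over t w : cutl (vertices t) (over t w) = t.
Proof.
elim: w => [|l IHl r _] /=; first exact: cutl_vertices.
by rewrite vertices_over leq_addr.
Qed.

Lemma cutr_over t w : cutr (vertices t) (over t w) = w.
Proof.
elim: w => [|l IHl r _] /=; first exact: cutr_vertices.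
by rewrite vertices_over leq_addr IHl.
Qed.

Lemma cutl_under t w : cutl (vertices t) (under t w) = t.
Proof.
elim: t => [|l _ r IHr] /=; first exact: cutl0.
by rewrite ifF; [rewrite subSS addKn IHr | lia].
Qed.

Lemma cutr_under t w : cutr (vertices t) (under t w) = w.
Proof.
elim: t => [|l _ r IHr] /=; first exact: cutr0.
by rewrite ifF; [rewrite subSS addKn IHr | lia].
Qed.

Lemma weak_le_cutl p u v : weak_le u v -> weak_le (cutl p u) (cutl p v).
Proof.
move=> le_uv; elim: le_uv p => {u v}
  [u|u v w _ IHuv _ IHvw|u u' v v' le_u IHu le_v IHv|u v w] p.
- exact: weak_le_refl.
- exact: weak_le_trans (IHuv p) (IHvw p).
(* Since [u] and [u'] have equal size, the cut takes the same branch in both trees. *)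
- rewrite /= -(weak_le_vertices le_u).
  by case: ifP => _; [apply: IHu | apply: weak_le_graft].
(* The left halves agree if the leaf lies in [u] or [v]; if it lies in [w], they differ by a
   rotation. *)
- rewrite /=; case: (leqP p (vertices u)) => le_pu.
    by rewrite ifT; [apply: weak_le_refl | lia].
  rewrite leq_subLR addSn; case: ifP => _; first exact: weak_le_refl.
  by rewrite -subnDA addSn addnS; apply: weak_le_rot.
Qed.

Lemma weak_le_cutr p u v : weak_le u v -> weak_le (cutr p u) (cutr p v).
Proof.
move=> le_uv; elim: le_uv p => {u v}
  [u|u v w _ IHuv _ IHvw|u u' v v' le_u IHu le_v IHv|u v w] p.
- exact: weak_le_refl.
- exact: weak_le_trans (IHuv p) (IHvw p).
- rewrite /= -(weak_le_vertices le_u).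
  by case: ifP => _; [apply: weak_le_graft | apply: IHv].
- rewrite /=; case: (leqP p (vertices u)) => le_pu.
    by rewrite ifT; [apply: weak_le_rot | lia].
  rewrite leq_subLR addSn; case: ifP => _; first exact: weak_le_refl.
  by rewrite -subnDA addSn addnS; apply: weak_le_refl.
Qed.

(** One rotation is spent at each vertex on the leftmost branch of [c]. *)
Lemma over_graftl_le a b c :
  weak_le (over (a \vee b)%tree c) (a \vee over b c)%tree.
Proof.
elim: c => [|c IHc d _] /=; first exact: weak_le_refl.
exact: weak_le_trans (weak_le_graftl _ _ _ IHc) (weak_le_rot _ _ _).
Qed.

Lemma graft_underl_le a b c :
  weak_le (under a b \vee c)%tree (under a (b \vee c)%tree).
Proof.
elim: a => [|d _ a IHa] /=; first exact: weak_le_refl.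
exact: weak_le_trans (weak_le_rot _ _ _) (weak_le_graftr _ _ _ IHa).
Qed.

Lemma over_cut_le p u : weak_le (over (cutl p u) (cutr p u)) u.
Proof.
elim: u p => [|l IHl r IHr] p /=; first exact: weak_le_refl.
case: ifP => _ /=; first exact: weak_le_graftl.
exact: weak_le_trans (over_graftl_le _ _ _) (weak_le_graftr _ _ _ (IHr _)).
Qed.

Lemma under_cut_ge p u : weak_le u (under (cutl p u) (cutr p u)).
Proof.
elim: u p => [|l IHl r IHr] p /=; first exact: weak_le_refl.
case: ifP => _ /=; last exact: weak_le_graftr.
exact: weak_le_trans (weak_le_graftl _ _ _ (IHl _)) (graft_underl_le _ _ _).
Qed.

Lemma weak_interval_cut t w u :
  weak_le (over t w) u /\ weak_le u (under t w) <->
  cutl (vertices t) u = t /\ cutr (vertices t) u = w.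
Proof.
split=> [[le_u u_le]|[]]; last first.
  (* Both bounds hold for a cut at any leaf, so [p] is freed from [t] before substituting. *)
  move: (vertices t) => p <- <-.
  by split; [apply: over_cut_le | apply: under_cut_ge].
split; apply: weak_le_anti.
- by move: (weak_le_cutl (vertices t) _ _ u_le); rewrite cutl_under.
- by move: (weak_le_cutl (vertices t) _ _ le_u); rewrite cutl_over.
- by move: (weak_le_cutr (vertices t) _ _ u_le); rewrite cutr_under.
- by move: (weak_le_cutr (vertices t) _ _ le_u); rewrite cutr_over.
Qed.

Lemma mcoeff_graftQ_leaf x y : (graftQ x y)@_Leaf = 0.
Proof.
rewrite raddf_sum big1 // => u _; rewrite raddf_sum big1 // => v _.
by rewrite /= mcoeffZ mcoeffU mulr0.
Qed.

Lemma mcoeff_graftQ x y a b : (graftQ x y)@_(a \vee b)%tree = x@_a * y@_b.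
Proof.
(* Adding [a] and [b] to the supports lets their term be split off even when its coefficient is
   zero; grafting being injective, all others vanish. *)
rewrite /graftQ (@bilin_extE _ _ _ (a |` msupp x)%fset (b |` msupp y)%fset);
  do ?exact: fsubsetU1.
rewrite raddf_sum (big_fsetD1 a) ?fset1U1 //= raddf_sum (big_fsetD1 b) ?fset1U1 //=.
rewrite mcoeffZ mcoeffUU mulr1.
rewrite big_seq big1 ?addr0 => [|v]; last first.
  rewrite !inE => /andP[/negPf neq_vb _].
  by rewrite /= mcoeffZ mcoeffU graft_eq neq_vb andbF mulr0.
rewrite big_seq big1 ?addr0 // => u; rewrite !inE => /andP[/negPf neq_ua _].
rewrite raddf_sum big1 // => v _.
by rewrite /= mcoeffZ mcoeffU graft_eq neq_ua mulr0.
Qed.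

Lemma mcoeff_tree_prod t w u :
  (tree_prod t w)@_u =
  ((cutl (vertices t) u == t) && (cutr (vertices t) u == w))%:R.
Proof.
elim: t w u => [|tl IHtl tr IHtr] w u.
  by rewrite /= cutl0 cutr0 eqxx mcoeffU eq_sym.
elim: w u => [|wl IHwl wr _] u.
  rewrite mcoeffU; congr (nat_of_bool _)%:R.
  apply/eqP/andP => [<-|[/eqP cutlu /eqP cutru]].
    by rewrite cutl_vertices cutr_vertices.
  (* An empty right half leaves every vertex to the left one, so [u] was cut at its last leaf. *)
  have := vertices_cut (vertices (tl \vee tr)%tree) u.
  by rewrite cutlu cutru addn0 => eq_vu; rewrite -cutlu eq_vu cutl_vertices.
case: u => [|a b].
  by rewrite mcoeffD !mcoeff_graftQ_leaf addr0 andbF.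
set t := (tl \vee tr)%tree.
have ->: tree_prod t (wl \vee wr)%tree =
    graftQ (tree_prod t wl) << wr >> +
    graftQ << tl >> (tree_prod tr (wl \vee wr)%tree) by [].
rewrite mcoeffD !mcoeff_graftQ IHwl IHtr !mcoeffU -/t.
have -> /= : vertices t = (vertices tl + vertices tr).+1 by [].
(* The side of the root on which the leaf lies selects the surviving summand: in the first case [a]
   is too large to be [tl], in the second too small to have [t] as its left half. *)
case: (leqP (vertices tl + vertices tr).+1 (vertices a)) => [le_ta|lt_at].
  rewrite (_ : tl == a = false) ?mul0r ?addr0; last first.
    by apply/eqP => eq_a; move: le_ta; rewrite -eq_a; lia.
  by rewrite graft_eq andbA (eq_sym wr) -natrM mulnb.
rewrite (_ : cutl _ a == t = false) ?mul0r ?add0r; last first.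
  apply/eqP => eq_a; have := vertices_cut (vertices tl + vertices tr).+1 a.
  by rewrite eq_a /=; lia.
rewrite graft_eq (eq_sym tl) -natrM mulnb.
by case: eqP => //= ->; rewrite subSS addKn.
Qed.

Theorem theorem5p1 (p q : nat) (t : Y p) (w : Y q) :
  prodQ << (t : bintree) >> << (w : bintree) >> =
  \sum_(u : Y (p + q)%N
        | `[< weak_leY (overY t w) u /\ weak_leY u (underY t w) >])
     (<< (u : bintree) >> : QY).
Proof.
rewrite /prodQ bilin_extU; apply/malgP => v.
rewrite mcoeff_tree_prod raddf_sum.
have inE u : `[< weak_leY (overY t w) u /\ weak_leY u (underY t w) >] =
    (cutl (vertices t) u == t) && (cutr (vertices t) u == w).
  apply/asboolP/andP => [/weak_interval_cut[-> ->]|[/eqP cutlu /eqP cutru]] //.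
  exact/weak_interval_cut.
under eq_bigl do rewrite inE.
under eq_bigr do rewrite /= mcoeffU.
(* The tree [v] has arbitrary size: it is either the index of exactly one term, or has the wrong
   size and coefficient zero on both sides. *)
have [size_v|size_v] := eqVneq (vertices v) (p + q)%N.
  pose v' := MkY (introT eqP size_v).
  rewrite big_mkcond (bigD1 v') //= eqxx big1 ?addr0; first by case: andP.
  move=> u /negPf neq_u; case: ifP => // _.
  by rewrite (_ : _ == v = (u == v')) ?neq_u // -val_eqE.
rewrite big1 => [|u _].
  case: andP => // -[/eqP cutlv /eqP cutrv]; case/eqP: size_v.
  by rewrite -(vertices_cut (vertices t) v) cutlv cutrv !verticesY.
by case: eqP => // eq_uv; rewrite -eq_uv verticesY eqxx in size_v.
Qed.
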